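(* Let $G=K_{n_1,n_2,\dots,n_k}$ be a complete $k$-partite graph with $m\ge 0$ full vertices (equivalently, $m$ partite sets of cardinality $1$). Then $IC(G)=2k-m$.
   Context: Graphs are finite and simple. $K_{n_1,\dots,n_k}$ denotes the complete $k$-partite graph with partite sets of orders $n_1,\dots,n_k\geq 1$. A full vertex of a graph of order $n$ is a vertex of degree $n-1$. A set $S$ of vertices is dominating if every vertex is in $S$ or adjacent to a vertex of $S$; it is independent if its vertices are pairwise nonadjacent; an independent dominating set is a set that is both independent and dominating. An independent coalition in $G$ consists of two disjoint independent sets of vertices $V_1,V_2$, neither of which is an independent dominating set but whose union $V_1\cup V_2$ is an independent dominating set; one says that $V_1$ and $V_2$ form an independent coalition. An $ic$-partition of $G$ is a partition $\pi=\{V_1,\dots,V_k\}$ of $V(G)$ into nonempty sets such that every $V_i\in\pi$ either is a singleton dominating set (a dominating set of cardinality 1), or is not an independent dominating set but forms an independent coalition with another set $V_j\in\pi$. The independent coalition number $IC(G)$ is the maximum number of classes of an $ic$-partition of $G$; the assertion $IC(G)=t$ includes that $G$ has an $ic$-partition. *)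

(* Defs.v *)
From mathcomp Require Import all_boot.

Set Implicit Arguments.
Unset Strict Implicit.
Unset Printing Implicit Defensive.

Record sgraph := SGraph {
  svertex :> finType;
  adj : rel svertex;
  adj_sym : symmetric adj;
  adj_irrefl : irreflexive adj
}.

Section IndependentCoalitions.
Variable G : sgraph.
Implicit Types (v : G) (S V W : {set G}) (P : {set {set G}}).

Definition degree v : nat := #|[set u | adj v u]|.

Definition full_vertex v : bool := degree v == #|G|.-1.

Definition dominating S : bool :=
  [forall v, (v \in S) || [exists u in S, adj v u]].

Definition independent S : bool :=
  [forall u in S, forall v in S, ~~ adj u v].

Definition independent_dominating S : bool := independent S && dominating S.

Definition independent_coalition V W : bool :=
  [&& [disjoint V & W], independent V, independent W,
      ~~ independent_dominating V, ~~ independent_dominating W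
    & independent_dominating (V :|: W)].

(* MathComp's [partition] already requires the blocks to be nonempty. *)
Definition ic_partition P : bool :=
  partition P [set: G] &&
  [forall V in P,
     ((#|V| == 1) && dominating V)
     || (~~ independent_dominating V
         && [exists W in P, (W != V) && independent_coalition V W])].

(* [IC t] reads "IC(G) = t": a relation rather than a function, because a graph
   need not have an ic-partition, in which case IC(G) has no value. *)
Definition IC (t : nat) : Prop :=
  (exists2 P, ic_partition P & #|P| = t) /\
  (forall P, ic_partition P -> #|P| <= t).

End IndependentCoalitions.

Section CompleteMultipartite.
Variables (k : nat) (n : 'I_k -> nat).

Definition multipartite_vertex : finType := {i : 'I_k & 'I_(n i)}.

Definition multipartite_adj : rel multipartite_vertex :=
  fun u v => tag u != tag v.

Lemma multipartite_adj_sym : symmetric multipartite_adj.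
Proof. by move=> u v; rewrite /multipartite_adj eq_sym. Qed.

Lemma multipartite_adj_irrefl : irreflexive multipartite_adj.
Proof. by move=> u; rewrite /multipartite_adj eqxx. Qed.

Definition complete_multipartite : sgraph :=
  SGraph multipartite_adj_sym multipartite_adj_irrefl.

End CompleteMultipartite.

(* Main.v *)
Require Import Defs.
From mathcomp Require Import all_boot zify.

(** In a complete multipartite graph the independent dominating sets are exactly
    the partite sets ([independent_dominating_part], [part_independent_dominating]):
    a nonempty independent set stays inside one partite set, and a vertex of that
    partite set can only be dominated by itself.

    Upper bound: a class [V] of an ic-partition, whether a singleton dominating
    set or a member of a coalition, therefore satisfies [V :|: W = part i] for
    some class [W], with [W = V] in the first case ([ic_partition_block]).  As
    classes are disjoint, the only classes inside [part i] are [V] and [W], and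
    there is only one when [part i] is a singleton.  Hence there are at most
    [1 + (1 < n i)] classes inside [part i] ([card_blocks_in_part]), and every
    class lies in some partite set.

    Lower bound: cutting every partite set with at least two vertices into one
    vertex and the rest gives an ic-partition ([split_ic_partition]) with exactly
    [1 + (1 < n i)] classes in each [part i] ([card_split_partition]).

    Finally the full vertices are those of the partite sets of order 1, so the
    sum over [i] of [1 + (1 < n i)] is [2 * k - m] ([sum_part_capacity]). *)

Set Implicit Arguments.
Unset Strict Implicit.
Unset Printing Implicit Defensive.

Section CompleteMultipartiteGraph.
Variables (k : nat) (n : 'I_k -> nat).
Hypothesis n_gt0 : forall i : 'I_k, 0 < n i.

Local Notation G := (complete_multipartite n).
Implicit Types (i : 'I_k) (v w : G) (S V W : {set G}) (P : {set {set G}}).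

(** * Partite sets *)

Definition part i : {set G} := [set v : G | tag v == i].

Definition first_vertex i : G := Tagged (fun i => 'I_(n i)) (Ordinal (n_gt0 i)).

Lemma in_part i v : (v \in part i) = (tag v == i).
Proof. by rewrite inE. Qed.

Lemma first_vertex_part i : first_vertex i \in part i.
Proof. by rewrite in_part. Qed.

Lemma adjE v w : adj v w = (tag v != tag w).
Proof. by []. Qed.

(** Any count of vertices that depends only on their partite sets, here the
    order of a partite set and the number of full vertices, reduces to this. *)
Lemma sum_vertices (F : 'I_k -> nat) :
  \sum_(v : G) F (tag v) = \sum_i n i * F i.
Proof.
rewrite (eq_bigr (fun i => \sum_(j < n i) F i)); last first.
  by move=> i _; rewrite sum_nat_const card_ord.
by rewrite (sig_big_dep (fun=> true) (fun _ _ => true) (fun i _ => F i)).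
Qed.

Lemma card_part i : #|part i| = n i.
Proof.
rewrite -sum1_card big_mkcond /=.
rewrite (eq_bigr (fun v : G => (tag v == i : nat))); last first.
  by move=> v _; rewrite in_part; case: (tag v == i).
rewrite (sum_vertices (fun j => (j == i : nat))).
rewrite (bigD1 i) //= eqxx muln1 big1 ?addn0 // => j /negbTE ->.
by rewrite muln0.
Qed.

(** Independence confines [S] to the partite set of [v]; conversely the
    neighbours of a vertex of that partite set are all outside [S], so it can
    only be dominated by belonging to [S]. *)
Lemma independent_dominating_part S v :
  independent_dominating S -> v \in S -> S = part (tag v).
Proof.
case/andP=> /forall_inP indS /forallP domS vS; apply/setP=> w.
have tagS u : u \in S -> tag u = tag v.
  move=> uS; have /forall_inP/(_ v vS) := indS u uS.
  by rewrite adjE negbK => /eqP.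
rewrite in_part; apply/idP/eqP=> [/tagS // | tag_w].
case/orP: (domS w) => // /exists_inP[u /tagS tag_u].
by rewrite adjE tag_w tag_u eqxx.
Qed.

Lemma sub_part_independent i S : S \subset part i -> independent S.
Proof.
move=> /subsetP sS; apply/forall_inP=> u /sS; rewrite in_part => /eqP tag_u.
apply/forall_inP=> v /sS; rewrite in_part => /eqP tag_v.
by rewrite adjE tag_u tag_v eqxx.
Qed.

Lemma part_independent_dominating i : independent_dominating (part i).
Proof.
rewrite /independent_dominating (sub_part_independent (subxx _)) /=.
apply/forallP=> v; rewrite in_part; case: eqP => //= /eqP tag_v.
by apply/exists_inP; exists (first_vertex i); first exact: first_vertex_part.
Qed.

(** * Upper bound *)

(** Taking [W = V] for a dominating singleton puts the two kinds of classes of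
    an ic-partition on the same footing. *)
Lemma ic_partition_block P V : ic_partition P -> V \in P ->
  exists i W, W \in P /\ V :|: W = part i.
Proof.
case/andP=> /and3P[_ _ set0P] /forall_inP icP VP.
have [v vV] : exists v, v \in V.
  by apply/set0Pn; apply: contraNneq set0P => <-.
exists (tag v); case/orP: (icP V VP) => [/andP[/cards1P[u eqV] domV] | ].
  exists V; split; rewrite // setUid; apply: independent_dominating_part => //.
  rewrite /independent_dominating domV andbT; apply: (@sub_part_independent (tag u)).
  by rewrite eqV sub1set in_part.
case/andP=> _ /exists_inP[W WP /andP[_ /and5P[_ _ _ _ /andP[_ idVW]]]].
by exists W; split=> //; apply: independent_dominating_part; rewrite // inE vV.
Qed.

Definition blocks_in_part P i : {set {set G}} := [set V in P | V \subset part i].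

(** Two classes already cover [part i], and any further class inside it would
    meet one of them. *)
Lemma card_blocks_in_part P i :
  ic_partition P -> #|blocks_in_part P i| <= 1 + (1 < n i).
Proof.
move=> icP; have /andP[/and3P[_ trivP set0P] _] := icP.
have block_neq0 V : V \in P -> exists v, v \in V.
  by move=> VP; apply/set0Pn; apply: contraNneq set0P => <-.
case: (ltnP 1 (n i)) => [_ | n_le1]; last first.
  (* A nonempty subset of the singleton [part i] is [part i] itself. *)
  rewrite addn0 -(cards1 (part i)) subset_leq_card //; apply/subsetP=> V.
  rewrite !inE => /andP[/block_neq0[v vV] sVi].
  rewrite eqEcard sVi card_part (leq_trans n_le1) // card_gt0.
  by apply/set0Pn; exists v.
have [-> | /set0Pn[V]] := eqVneq (blocks_in_part P i) set0.
  by rewrite cards0.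
rewrite inE => /andP[VP /subsetP sVi].
have [j [W [WP VWj]]] := ic_partition_block icP VP.
have [v vV] := block_neq0 V VP.
have {}VWj : V :|: W = part i.
  have /eqP <- : tag v == i by rewrite -in_part sVi.
  by apply: independent_dominating_part; rewrite ?VWj ?part_independent_dominating
    // -VWj inE vV.
have sVW : blocks_in_part P i \subset [set V; W].
  apply/subsetP=> U; rewrite inE => /andP[UP /subsetP sUi].
  have [u uU] := block_neq0 U UP.
  (* [U] shares the vertex [u] with [V] or [W], hence is equal to it. *)
  have := sUi u uU; rewrite -VWj !inE.
  case/orP=> uX; apply/orP; [left | right];
    by rewrite -(def_pblock trivP UP uU) (def_pblock trivP _ uX).
apply: leq_trans (subset_leq_card sVW) _.
by rewrite cards2; case: (V != W).
Qed.

Lemma ic_partition_card P :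
  ic_partition P -> #|P| <= \sum_i (1 + (1 < n i)).
Proof.
move=> icP; have sP : P \subset \bigcup_i blocks_in_part P i.
  apply/subsetP=> V VP; have [i [W [_ VWi]]] := ic_partition_block icP VP.
  by apply/bigcupP; exists i; rewrite // inE VP -VWi subsetUl.
apply: leq_trans (subset_leq_card sP) _.
apply: (@leq_trans (\sum_i #|blocks_in_part P i|)); last first.
  by apply: leq_sum => i _; apply: card_blocks_in_part.
elim/big_rec2: _ => [|i s A _ IH]; first by rewrite cards0.
by apply: leq_trans (leq_card_setU _ _) _; rewrite leq_add2l.
Qed.

(** * Lower bound *)

Definition split_color v : 'I_k * bool := (tag v, v == first_vertex (tag v)).

Definition color_class (c : 'I_k * bool) : {set G} := [set v | split_color v == c].

Definition split_partition : {set {set G}} :=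
  preim_partition split_color [set: G].

Lemma first_vertex_color i : split_color (first_vertex i) = (i, true).
Proof. by rewrite /split_color eqxx. Qed.

Lemma split_color_surj i b : b || (1 < n i) -> exists v, split_color v = (i, b).
Proof.
case: b => [_ | /= n_gt1]; first by exists (first_vertex i); rewrite first_vertex_color.
exists (Tagged (fun i => 'I_(n i)) (Ordinal n_gt1)).
by rewrite /split_color /first_vertex /= eq_Tagged.
Qed.

(** The color [(i, false)] is missing exactly when [part i] is reduced to its
    first vertex. *)
Lemma split_color_admissible v :
  (split_color v).2 || (1 < n (split_color v).1).
Proof.
rewrite /=; case: eqP => //= neq_v; case: ltnP => // n_le1; case: neq_v.
have part1 : #|part (tag v)| <= 1 by rewrite card_part.
by apply: (card_le1_eqP part1); rewrite in_part.
Qed.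

Lemma split_partitionE :
  split_partition = color_class @: (split_color @: [set: G]).
Proof.
rewrite -imset_comp; apply: eq_imset => v /=; apply/setP=> w.
by rewrite !inE eq_sym.
Qed.

Lemma split_colorsE :
  split_color @: [set: G] = [set c : 'I_k * bool | c.2 || (1 < n c.1)].
Proof.
apply/setP=> -[i b]; rewrite inE; apply/imsetP/idP=> [[v _ ->] | ib_ok].
  exact: split_color_admissible.
by have [v eq_v] := split_color_surj ib_ok; exists v; rewrite ?inE.
Qed.

Lemma card_split_partition : #|split_partition| = \sum_i (1 + (1 < n i)).
Proof.
rewrite split_partitionE card_in_imset; last first.
  (* Colors that are attained have nonempty, hence distinct, classes. *)
  move=> _ d /imsetP[v _ ->] _ /setP/(_ v).
  by rewrite !inE eqxx => /esym/eqP.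
rewrite split_colorsE -sum1_card big_mkcond /=.
rewrite (eq_bigr (fun c : 'I_k * bool => (c.2 || (1 < n c.1) : nat))).
  rewrite -(pair_bigA _ (fun i b => (b || (1 < n i) : nat))) /=.
  by apply: eq_bigr => i _; rewrite big_bool.
by move=> c _; rewrite inE; case: (_ || _).
Qed.

Lemma color_class_sub i b : color_class (i, b) \subset part i.
Proof. by apply/subsetP=> v; rewrite !inE => /eqP[-> _]. Qed.

Lemma color_class_union i b :
  color_class (i, b) :|: color_class (i, ~~ b) = part i.
Proof.
apply/setP=> v; rewrite !inE /split_color !xpair_eqE -andb_orr.
by case: (v == _); case: b; rewrite andbT.
Qed.

Lemma color_class_disjoint i b :
  [disjoint color_class (i, b) & color_class (i, ~~ b)].
Proof.
rewrite -setI_eq0; apply/eqP/setP=> v; rewrite !inE.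
by case: eqP => //= ->; rewrite xpair_eqE eqxx; case: b.
Qed.

(** A color class is a nonempty proper subset of a partite set with two or more
    vertices, so it is not itself a partite set. *)
Lemma color_class_not_id i b : 1 < n i ->
  ~~ independent_dominating (color_class (i, b)).
Proof.
move=> n_gt1.
have [v col_v] : exists v, split_color v = (i, b).
  by apply: split_color_surj; rewrite n_gt1 orbT.
have [w col_w] : exists w, split_color w = (i, ~~ b).
  by apply: split_color_surj; rewrite n_gt1 orbT.
apply/negP=> /independent_dominating_part/(_ (_ : v \in _)).
rewrite inE col_v eqxx => /(_ isT)/setP/(_ w).
case: col_v col_w => -> _ col_w; rewrite in_part inE col_w.
by case: col_w => -> _; rewrite xpair_eqE !eqxx; case: b.
Qed.

(** The two color classes of a partite set of order at least 2 are coalition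
    partners; the color class of one of order 1 is a dominating singleton. *)
Lemma split_ic_partition : ic_partition split_partition.
Proof.
apply/andP; split; first exact: preim_partitionP.
have memP c : c.2 || (1 < n c.1) -> color_class c \in split_partition.
  by move=> c_ok; rewrite split_partitionE split_colorsE imset_f // inE.
apply/forall_inP=> V; rewrite split_partitionE split_colorsE.
case/imsetP=> -[i b]; rewrite inE /= => ib_ok ->.
have [n_gt1 | n_le1] := ltnP 1 (n i); last first.
  have {ib_ok} -> : b by move: ib_ok; rewrite ltnNge n_le1 orbF.
  have -> : color_class (i, true) = part i.
    apply/eqP; rewrite eqEcard color_class_sub card_part (leq_trans n_le1) //.
    rewrite card_gt0; apply/set0Pn; exists (first_vertex i).
    by rewrite inE first_vertex_color.
  rewrite card_part eqn_leq n_le1 n_gt0 /=.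
  by case/andP: (part_independent_dominating i) => _ ->.
apply/orP; right; rewrite color_class_not_id //=.
apply/exists_inP; exists (color_class (i, ~~ b)).
  by rewrite -split_colorsE -split_partitionE memP //= n_gt1 orbT.
apply/andP; split.
  have [v col_v] : exists v, split_color v = (i, b).
    by apply: split_color_surj.
  apply/eqP=> /setP/(_ v); rewrite !inE col_v eqxx xpair_eqE eqxx.
  by case: (b).
rewrite /independent_coalition color_class_disjoint color_class_union.
by rewrite !color_class_not_id // part_independent_dominating
  !(sub_part_independent (color_class_sub _ _)).
Qed.

(** * Full vertices *)

(** The non-neighbours of [v], itself included, form its partite set. *)
Lemma full_vertexE v : full_vertex v = (n (tag v) == 1).
Proof.
have -> : full_vertex v = (#|~: part (tag v)| == #|G|.-1).
  rewrite /full_vertex /degree; congr (#|pred_of_set _| == _).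
  by apply/setP=> w; rewrite !inE adjE eq_sym.
have := cardsC (part (tag v)); have := n_gt0 (tag v); rewrite card_part.
by move=> *; apply/eqP/eqP; lia.
Qed.

Lemma card_full_vertices :
  #|[set v : G | full_vertex v]| = \sum_i (n i == 1).
Proof.
rewrite -sum1_card big_mkcond /=.
rewrite (eq_bigr (fun v : G => (n (tag v) == 1 : nat))); last first.
  by move=> v _; rewrite inE full_vertexE; case: (_ == 1).
rewrite (sum_vertices (fun i => (n i == 1 : nat))); apply: eq_bigr => i _.
by case: eqP => [-> | _]; rewrite ?muln0.
Qed.

Lemma sum_part_capacity :
  \sum_i (1 + (1 < n i)) = 2 * k - #|[set v : G | full_vertex v]|.
Proof.
(* Each partite set contributes [1 + 1] or [2 + 0] to the sum of the two sums. *)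
suff <- : \sum_i (1 + (1 < n i)) + \sum_i (n i == 1) = 2 * k.
  by rewrite card_full_vertices addnK.
rewrite -big_split /= (eq_bigr (fun=> 2)) => [|i _].
  by rewrite sum_nat_const card_ord mulnC.
by case: (n i) (n_gt0 i) => [|[|?]].
Qed.

End CompleteMultipartiteGraph.

Theorem proposition3p4 (k : nat) (n : 'I_k -> nat) (m : nat)
    (k_gt0 : 0 < k) (n_gt0 : forall i : 'I_k, 0 < n i)
    (full_m : #|[set v : complete_multipartite n | full_vertex v]| = m) :
  IC (complete_multipartite n) (2 * k - m).
Proof.
rewrite -full_m -(sum_part_capacity n_gt0); split; last exact: ic_partition_card.
exists (split_partition n_gt0); first exact: split_ic_partition.
exact: card_split_partition.
Qed.
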